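(* Let $\mathbb K$ be a field with prime subfield $\underline{\mathbb K}$, and let $f_1,f_2,\ldots$ be a sequence with respect to which the free associative algebra $F_2(\underline{\mathbb K})=\underline{\mathbb K}\langle x,y\rangle$ stabilizes. Let $A$ be an associative unital algebra over $\mathbb K$ and let $a,b\in A$. Then either there exists $N$ such that $f_i(a,b)=0$ for all $i\ge N$, or the $\mathbb K$-algebra homomorphism $$F_2(\mathbb K)=\mathbb K\langle x,y\rangle\to A,\qquad x\mapsto a,\quad y\mapsto b,$$ is injective.
   Context: The prime subfield $\underline{\mathbb K}$ is the subfield of $\mathbb K$ generated by $1$. $F_2(\mathbb F)=\mathbb F\langle x,y\rangle$ denotes the free associative unital algebra on two generators over a field $\mathbb F$. An associative unital algebra $B$ stabilizes with respect to a list $b_1,b_2,\ldots\in B\setminus\{0\}$ if every nonzero two-sided ideal of $B$ contains at least one $b_i$, and $b_{i+1}\in Bb_iB$ for all $i$, where $Bb_iB$ is the two-sided ideal generated by $b_i$. (Consequently every nonzero two-sided ideal of $B$ contains all $b_i$ from some index on.) For $f\in\underline{\mathbb K}\langle x,y\rangle$, $f(a,b)\in A$ denotes the result of substituting $x=a$, $y=b$. *)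

(* Defs.v *)
From HB Require Import structures.
From mathcomp Require Import all_boot all_algebra.
From mathcomp Require Import boolp.
From mathcomp Require Import finmap monalg.
Set Implicit Arguments.
Unset Strict Implicit.
Unset Printing Implicit Defensive.

Import GRing.Theory.
Local Open Scope ring_scope.

(* [divring_closed] subsets of a field are its subfields; the boolean
   predicates range over all subsets because [boolp] is classical. *)
Definition prime_subfield_pred (K : fieldType) : {pred K} :=
  fun x => `[< forall S : {pred K}, divring_closed S -> x \in S >].
Arguments prime_subfield_pred K _ : clear implicits.

Record prime_subfield (K : fieldType) : predArgType := PrimeSubfield {
  prime_subfield_val : K;
  _ : prime_subfield_val \in prime_subfield_pred K
}.

Lemma prime_subfield_divring_closed (K : fieldType) :
  divring_closed (prime_subfield_pred K).
Proof.
split=> [|x y /asboolP xP /asboolP yP|x y /asboolP xP /asboolP yP];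
  apply/asboolP => S Sdiv; have [S1 SB SV] := Sdiv => //.
- by apply: SB; [apply: xP|apply: yP].
- by apply: SV; [apply: xP|apply: yP].
Qed.

HB.instance Definition _ (K : fieldType) :=
  GRing.isDivringClosed.Build K (prime_subfield_pred K)
    (@prime_subfield_divring_closed K).

HB.instance Definition _ (K : fieldType) :=
  [isSub of prime_subfield K for @prime_subfield_val K].
HB.instance Definition _ (K : fieldType) :=
  [Choice of prime_subfield K by <:].
HB.instance Definition _ (K : fieldType) :=
  [SubChoice_isSubComUnitRing of prime_subfield K by <:].
HB.instance Definition _ (K : fieldType) :=
  [SubComUnitRing_isSubIntegralDomain of prime_subfield K by <:].
HB.instance Definition _ (K : fieldType) :=
  [SubIntegralDomain_isSubField of prime_subfield K by <:].

(* The monoid algebra of the free monoid on [bool], i.e. of the words in the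
   two letters x = [false] and y = [true]. *)
Definition free2 (F : fieldType) : Type := {malg F[{fmonom bool}]}.

HB.instance Definition _ (F : fieldType) :=
  GRing.Lalgebra.copy (free2 F) {malg F[{fmonom bool}]}.

Lemma free2_scalerAr (F : fieldType) (c : F) (p q : free2 F) :
  c *: (p * q) = p * (c *: q).
Proof.
rewrite -!mul_malgC !mulrA; congr (_ * q).
rewrite [p]monalgE mulr_suml mulr_sumr; apply: eq_bigr => u _.
by rewrite !malgM_def !fgmulUU mul1m mulm1 mulrC.
Qed.

(* [monalg] provides [algType] only for commutative monoids. *)
HB.instance Definition _ (F : fieldType) :=
  GRing.Lalgebra_isAlgebra.Build F (free2 F) (@free2_scalerAr F).

Definition free2_x (F : fieldType) : free2 F := << fmu false >>.
Definition free2_y (F : fieldType) : free2 F := << fmu true >>.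

Definition eval_word (A : nzRingType) (a b : A) (w : {fmonom bool}) : A :=
  \prod_(i <- (w : seq bool)) (if i then b else a).

Lemma eval_word_mmorphism (A : nzRingType) (a b : A) :
  mmorphism (eval_word a b).
Proof.
split=> [u v|]; rewrite /eval_word; first by rewrite fmM big_cat.
by rewrite fm1 big_nil.
Qed.

HB.instance Definition _ (A : nzRingType) (a b : A) :=
  isMultiplicative.Build {fmonom bool} A (eval_word a b)
    (eval_word_mmorphism a b).

Definition free2_eval (K : fieldType) (A : algType K) (a b : A) :
    free2 K -> A :=
  mmap (in_alg A) (eval_word a b).

Lemma free2_eval_is_linear (K : fieldType) (A : algType K) (a b : A) :
  linear (free2_eval a b).
Proof.
move=> c p q; rewrite /free2_eval mmapD.
by rewrite mmapZ /= -scalerAl mul1r.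
Qed.

Lemma free2_eval_is_multiplicative (K : fieldType) (A : algType K) (a b : A) :
  monoid_morphism (free2_eval a b).
Proof.
have [eM e1] : multiplicative (free2_eval a b).
  apply: commr_mmap_is_multiplicative => p u v /=.
  by rewrite /GRing.comm -scalerAl -scalerAr mul1r mulr1.
by split.
Qed.

HB.instance Definition _ (K : fieldType) (A : algType K) (a b : A) :=
  GRing.isLinear.Build K (free2 K) A _ (free2_eval a b)
    (free2_eval_is_linear a b).
HB.instance Definition _ (K : fieldType) (A : algType K) (a b : A) :=
  GRing.isMonoidMorphism.Build (free2 K) A (free2_eval a b)
    (free2_eval_is_multiplicative a b).

Lemma free2_eval_x (K : fieldType) (A : algType K) (a b : A) :
  free2_eval a b (free2_x K) = a.
Proof.
by rewrite /free2_eval mmapU /= scale1r mul1r /eval_word fmU big_seq1.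
Qed.

Lemma free2_eval_y (K : fieldType) (A : algType K) (a b : A) :
  free2_eval a b (free2_y K) = b.
Proof.
by rewrite /free2_eval mmapU /= scale1r mul1r /eval_word fmU big_seq1.
Qed.

Definition free2_of_prime (K : fieldType) (p : free2 (prime_subfield K)) :
    free2 K :=
  \sum_(w <- msupp p) << val p@_w *g w >>.

Record two_sided_ideal (F : fieldType) (B : algType F) (I : B -> Prop) : Prop :=
  TwoSidedIdeal {
    ideal_zero : I 0;
    ideal_add : forall u v, I u -> I v -> I (u + v);
    ideal_scale : forall (c : F) u, I u -> I (c *: u);
    ideal_mull : forall c u, I u -> I (c * u);
    ideal_mulr : forall c u, I u -> I (u * c)
  }.

Definition ideal_gen (F : fieldType) (B : algType F) (b u : B) : Prop :=
  forall I : B -> Prop, two_sided_ideal I -> I b -> I u.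

Definition stabilizes (F : fieldType) (B : algType F) (b : nat -> B) : Prop :=
  [/\ forall i, b i != 0,
      forall I : B -> Prop, two_sided_ideal I -> (exists2 u, I u & u != 0) ->
        exists i, I (b i)
    & forall i, ideal_gen (b i) (b i.+1)].

(* Main.v *)
(** Let [I] be the kernel and suppose that it contains a nonzero sum
    [g = c_1 r_1 + ... + c_n r_n] with [c_i] in [K] and [r_i] over the prime
    subfield.  For every word [w] the element [g w r_1 - r_1 w g] lies in [I]
    and is such a sum with [n - 1] terms.  If all these elements vanish, comparing
    coefficients for [w = x^m y] with [m] large shows that [g] is a scalar
    multiple of [r_1], so that [r_1] is in [I].  By induction on [n], [I] contains
    a nonzero element defined over the prime subfield, and the stabilization
    hypothesis applies to the ideal of the elements of [I] of that kind. *)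
Require Import Defs.
From HB Require Import structures.
From mathcomp Require Import all_boot all_algebra.
From mathcomp Require Import boolp finmap monalg.
Set Implicit Arguments.
Unset Strict Implicit.
Unset Printing Implicit Defensive.

Import GRing.Theory.
Local Open Scope fset_scope.
Local Open Scope ring_scope.

Local Notation "x * y" := (mmul x y) : monom_scope.

Section SeparatingWord.
Context (I : choiceType) (i j : I).
Hypothesis neq_ij : i != j.

(** The word [i^n j]: its final [j] marks a position that a short prefix cannot shift. *)
Definition sep_word (n : nat) : {fmonom I} := FMonom (rcons (nseq n i) j).

(** If [u] were shorter than [u'], the letter at position [size u + n] would be the marker [j] on
    the left, but would fall inside the block [i^n] on the right. *)
Lemma sep_word_size_leq (n : nat) (u v u' v' : {fmonom I}) :
    (u * sep_word n * v = u' * sep_word n * v')%M ->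
  (size u' <= n)%N -> (size u' <= size u)%N.
Proof.
move=> e le_n; rewrite leqNgt; apply/negP => lt_uu'.
have := congr1 (fun m : {fmonom I} => nth i m (size u + n)) e.
rewrite !fmM -!catA !nth_cat !size_rcons size_nseq !nth_rcons !size_nseq.
have -> : (size u + n < size u = false)%N by rewrite ltnNge leq_addr.
have -> : (size u + n < size u' = false)%N.
  by rewrite ltnNge (leq_trans le_n) ?leq_addl.
have lt_n : (size u + n - size u' < n)%N.
  by rewrite ltn_subLR ?ltn_add2r // (leq_trans le_n) ?leq_addl.
rewrite addKn ltnSn ltnn eqxx (ltn_trans lt_n) // lt_n nth_nseq lt_n => /eqP.
by rewrite eq_sym (negPf neq_ij).
Qed.

Lemma sep_word_inj (n : nat) (u v u' v' : {fmonom I}) :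
    (u * sep_word n * v = u' * sep_word n * v')%M ->
  (size u <= n)%N -> (size u' <= n)%N -> u = u' /\ v = v'.
Proof.
move=> e le_un le_u'n.
have eq_sz : size u = size u'.
  apply/eqP; rewrite eqn_leq (sep_word_size_leq (esym e) le_un).
  exact: sep_word_size_leq e le_u'n.
have /eqP := congr1 (fun m : {fmonom I} => m : seq I) e.
rewrite !fmM -!catA eqseq_cat // eqseq_cat //.
by case/and3P=> /eqP eq_u _ /eqP eq_v; split; apply/eqP; rewrite fmP; apply/eqP.
Qed.

(** By [sep_word_inj], only the pair [(u, v)] can contribute to this coefficient. *)
Lemma mcoeff_sep_word (R : nzRingType) (p q : {malg R[{fmonom I}]}) (n : nat)
    (u v : {fmonom I}) :
    (forall w : {fmonom I}, w \in msupp p -> size w <= n)%N -> (size u <= n)%N ->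
  (p * << sep_word n >> * q)@_(u * sep_word n * v)%M = p@_u * q@_v.
Proof.
move=> le_pn le_un.
have coefE (w : {fmonom I}) : (size w <= n)%N ->
    (<< p@_w *g (w * sep_word n)%M >> * q)@_(u * sep_word n * v)%M =
    (p@_u * q@_v) *+ (w == u).
  (* Adding [v] to the support of [q] lets its term be split off even when [q@_v] is zero. *)
  move=> le_wn; rewrite (mcoeffMlw (d1 := [fset (w * sep_word n)%M])
    (d2 := v |` msupp q) _ msuppU_le (fsubsetUr _ _)).
  rewrite big_seq_fset1 mcoeffUU (big_fsetD1 v) ?fset1U1 //= big1_fset.
    rewrite addr0; have [->|neq_wu] := eqVneq w u; first by rewrite eqxx.
    case: eqP => // /sep_word_inj[] // eq_wu _.
    by rewrite eq_wu eqxx in neq_wu.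
  move=> v'; rewrite !inE => /andP[neq_v'v _] _.
  case: eqP => // /sep_word_inj[] // _ eq_v.
  by rewrite eq_v eqxx in neq_v'v.
rewrite [p * _]malgM_def fgmulgU mulr_suml raddf_sum /=.
transitivity (\sum_(w <- msupp p) (p@_u * q@_v) *+ (w == u)).
  by apply: eq_big_seq => w w_p; rewrite mulr1 coefE ?le_pn.
have [u_p|/mcoeff_outdom p0] := boolP (u \in msupp p); last first.
  by rewrite p0 mul0r big1 // => w _; rewrite mul0rn.
rewrite (big_fsetD1 u) //= eqxx big1_fset ?addr0 // => w.
by rewrite !inE => /andP[/negPf->].
Qed.

Lemma intertwining_colinear (F : fieldType) (p q : {malg F[{fmonom I}]}) :
    p != 0 ->
    (forall w : {fmonom I}, q * << w >> * p = p * << w >> * q) ->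
  exists c, q = c *: p.
Proof.
rewrite -msupp_eq0 => /fset0Pn[u]; rewrite -mcoeff_neq0 => pu_neq0 pqC.
exists (q@_u / p@_u); apply/malgP => v; rewrite mcoeffZ mulrAC.
apply/(canRL (mulfK pu_neq0)).
pose d := v |` (msupp p `|` msupp q).
(* This bounds [v] and all words of both supports, so [mcoeff_sep_word] applies with either [p] or
   [q] as the left factor. *)
pose n := (\max_(w <- d) size (w : seq I))%N.
have le_n (w : {fmonom I}) : w \in d -> (size w <= n)%N.
  by move=> w_d; apply: leq_bigmax_seq.
rewrite -(@mcoeff_sep_word _ _ _ n) ?pqC ?mcoeff_sep_word; first exact: mulrC.
all: try by [apply: le_n; rewrite !inE eqxx|
  move=> w w_s; apply: le_n; rewrite !inE w_s ?orbT].
Qed.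

End SeparatingWord.

(** The terms [d *: (phi r * phi w * phi r)] cancel, which shortens the sum by one; the scalars are
    central, so the other terms keep their coefficients and stay in the image of [phi]. *)
Lemma intertwiner_sum (R : comNzRingType) (A : nzRingType) (B : algType R)
    (phi : {rmorphism A -> B}) (T : Type) (s : seq T) (c : T -> R) (t : T -> A)
    (d : R) (r w : A) (g : B) :
    g = d *: phi r + \sum_(x <- s) c x *: phi (t x) ->
  g * phi w * phi r - phi r * phi w * g =
    \sum_(x <- s) c x *: phi (t x * w * r - r * w * t x).
Proof.
move=> ->; rewrite !mulrDl mulrDr -!scalerAl -scalerAr opprD addrACA subrr add0r.
rewrite !mulr_suml mulr_sumr -sumrB; apply: eq_bigr => x _.
by rewrite rmorphB !rmorphM scalerBr -!scalerAl -scalerAr.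
Qed.

Definition free2_word (F : fieldType) (w : {fmonom bool}) : free2 F := << w >>.

Section PrimeDescent.
Context (K : fieldType).
Implicit Types p q : free2 (prime_subfield K).

Lemma mcoeff_free2_of_prime p (w : {fmonom bool}) :
  (free2_of_prime p)@_w = val p@_w.
Proof.
rewrite /free2_of_prime raddf_sum /=.
under eq_bigr do rewrite mcoeffU.
have [w_p|w_p] := boolP (w \in msupp p).
  rewrite (big_fsetD1 w) //= eqxx big1_fset ?addr0 // => v.
  by rewrite !inE => /andP[/negPf->].
rewrite (mcoeff_outdom w_p) big1_fset // => v v_p _.
by case: eqP => // eq_vw; rewrite -eq_vw v_p in w_p.
Qed.

Lemma free2_of_prime_is_additive : zmod_morphism (@free2_of_prime K).
Proof.
move=> p q; apply/malgP => w.
rewrite [LHS]mcoeff_free2_of_prime [RHS]mcoeffB mcoeffB rmorphB.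
by congr (_ - _); apply/esym/mcoeff_free2_of_prime.
Qed.

HB.instance Definition _ :=
  GRing.isZmodMorphism.Build (free2 (prime_subfield K)) (free2 K)
    (@free2_of_prime K) free2_of_prime_is_additive.

Lemma free2_of_primeZ (c : prime_subfield K) p :
  free2_of_prime (c *: p) = val c *: free2_of_prime p.
Proof.
apply/malgP => w.
rewrite [LHS]mcoeff_free2_of_prime [RHS]mcoeffZ mcoeffZ rmorphM.
by congr (_ * _); apply/esym/mcoeff_free2_of_prime.
Qed.

Lemma free2_of_prime_word (w : {fmonom bool}) :
  free2_of_prime (free2_word (prime_subfield K) w) = free2_word K w.
Proof.
by apply/malgP => v; rewrite mcoeff_free2_of_prime !mcoeffU rmorphMn rmorph1.
Qed.

Lemma free2_of_prime_is_monoid_morphism : monoid_morphism (@free2_of_prime K).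
Proof.
split=> [|p q].
  by apply/malgP => w; rewrite mcoeff_free2_of_prime !mcoeff1 rmorph_nat.
(* Both products can then be expanded over the same finite sets of words. *)
have supp_sub (r : free2 (prime_subfield K)) : msupp (free2_of_prime r) `<=` msupp r.
  apply/fsubsetP => w; rewrite -!mcoeff_neq0 mcoeff_free2_of_prime.
  by apply: contra_neq => ->; rewrite raddf0.
apply/malgP => w.
rewrite mcoeff_free2_of_prime mcoeffMl (mcoeffMlw _ (supp_sub p) (supp_sub q)).
rewrite raddf_sum; apply: eq_bigr => u _; rewrite raddf_sum.
by apply: eq_bigr => v _; rewrite !mcoeff_free2_of_prime raddfMn -rmorphM.
Qed.

HB.instance Definition _ :=
  GRing.isMonoidMorphism.Build (free2 (prime_subfield K)) (free2 K)
    (@free2_of_prime K) free2_of_prime_is_monoid_morphism.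

Lemma ideal_meets_prime (J : free2 K -> Prop) (g : free2 K) :
    two_sided_ideal J -> J g -> g != 0 ->
  exists2 r : free2 (prime_subfield K), J (free2_of_prime r) & r != 0.
Proof.
move=> idJ Jg g_neq0; have J_sub u v : J u -> J v -> J (u - v).
  move=> Ju Jv; apply: (ideal_add idJ) => //.
  by rewrite -scaleN1r; apply: (ideal_scale idJ).
(* The expansion of [g] into monomials is such a sum, since words have coefficient 1. *)
have [s def_g] : exists s : seq (K * free2 (prime_subfield K)),
    g = \sum_(x <- s) x.1 *: free2_of_prime x.2.
  exists [seq (g@_w, free2_word (prime_subfield K) w) | w <- msupp g].
  rewrite big_map {1}[g]monalgE; apply: eq_bigr => w _ /=.
  by rewrite free2_of_prime_word -mul_malgC malgM_def fgmulUU mulr1 mul1m.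
(* Induction on a bound for the number of terms, with [g] general because it is replaced by an
   intertwiner. *)
elim: {s}(size s) {-2}s (leqnn (size s)) g Jg g_neq0 def_g => [|n IHn].
  by case=> // _ g _ + def_g; rewrite def_g big_nil eqxx.
case=> [|[c r] s] /= le_sn g Jg g_neq0 def_g.
  by move: g_neq0; rewrite def_g big_nil eqxx.
rewrite big_cons /= in def_g.
(* A zero [r] is dropped, as colinearity needs a nonzero element. *)
have [r0|r_neq0] := eqVneq r 0.
  by apply: (IHn s) Jg g_neq0 _ => //; rewrite def_g r0 raddf0 scaler0 add0r.
have ir_neq0 : free2_of_prime r != 0.
  apply: contra_neq r_neq0 => ir0; apply/malgP => w; apply: val_inj.
  by rewrite -mcoeff_free2_of_prime ir0 !mcoeff0 raddf0.
have [gr_comm|] := pselect (forall w : {fmonom bool},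
    g * free2_word K w * free2_of_prime r =
    free2_of_prime r * free2_word K w * g).
  have [d def_gr] := @intertwining_colinear _ false true isT _ _ _ ir_neq0 gr_comm.
  have d_neq0 : d != 0.
    by apply: contra_neq g_neq0 => d0; rewrite def_gr d0 scale0r.
  exists r => //; rewrite -[free2_of_prime r](scalerK d_neq0) -def_gr.
  exact: (ideal_scale idJ).
move=> /existsNP[w /eqP]; rewrite -subr_eq0.
pose w' := free2_word (prime_subfield K) w.
(* The commutator-like expression is formed over the prime subfield, so the new sum again has the
   required shape. *)
pose h (x : K * free2 (prime_subfield K)) := (x.1, x.2 * w' * r - r * w' * x.2).
move=> h_neq0; apply: (IHn [seq h x | x <- s]) h_neq0 _.
- by rewrite size_map.
- apply: J_sub; last exact: (ideal_mull idJ).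
  by do 2!apply: (ideal_mulr idJ).
by rewrite big_map -free2_of_prime_word (intertwiner_sum _ def_g).
Qed.

End PrimeDescent.

Theorem corollary1 (K : fieldType) (f : nat -> free2 (prime_subfield K))
    (hf : stabilizes f) (A : algType K) (a b : A) :
  (exists N : nat, forall i : nat, (N <= i)%N ->
     free2_eval a b (free2_of_prime (f i)) = 0) \/
  injective (free2_eval a b : {lrmorphism free2 K -> A}).
Proof.
have [inj|] := pselect (forall g : free2 K, free2_eval a b g = 0 -> g = 0).
  by right=> u v /= eq_uv; apply/subr0_eq/inj; rewrite raddfB /= eq_uv subrr.
move=> /existsNP[g /not_implyP[ev_g /eqP g_neq0]]; left.
have [_ f_cofinal f_decr] := hf.
have idK : two_sided_ideal (fun g : free2 K => free2_eval a b g = 0).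
  split=> [|u v eu ev|c u eu|c u eu|c u eu]; first exact: raddf0.
  - by rewrite raddfD /= eu ev addr0.
  - by rewrite linearZ /= eu scaler0.
  - by rewrite rmorphM /= eu mulr0.
  - by rewrite rmorphM /= eu mul0r.
(* The part of the kernel defined over the prime subfield; [ideal_meets_prime] makes it nonzero. *)
pose J p := free2_eval a b (@free2_of_prime K p) = 0.
have idJ : two_sided_ideal J.
  split=> [|u v Ju Jv|c u Ju|c u Ju|c u Ju]; rewrite /J.
  - by rewrite !raddf0.
  - by rewrite 2!raddfD /= Ju Jv addr0.
  - by rewrite free2_of_primeZ; apply: (ideal_scale idK).
  - by rewrite rmorphM; apply: (ideal_mull idK).
  - by rewrite rmorphM; apply: (ideal_mulr idK).
have [N JN] := f_cofinal J idJ (ideal_meets_prime idK ev_g g_neq0).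
(* Once [J] contains one term of the sequence, it contains the ideal generated by that term, hence
   the next term. *)
exists N => i /subnKC <-; elim: (i - N)%N => [|m IHm]; first by rewrite addn0.
by rewrite addnS; apply: (f_decr (N + m)%N J idJ IHm).
Qed.
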